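(* For every triple of positive integers $k,r,m$ there exists a positive integer $n_0$ with the following property: for every integer $n\geq n_0$ and every $r$-coloring of the set of all variable words over $k$ of length $n$, there exists an $m$-dimensional variable word $w(v_0,\dots,v_{m-1})$ over $k$ of length $n$ such that the set of all variable words over $k$ reduced by $w(v_0,\dots,v_{m-1})$ is monochromatic. Denote the least such $n_0$ by $GR(k,m,r)$. Moreover, the numbers $GR(k,m,r)$ are upper bounded by a primitive recursive function belonging to the class $\mathcal{E}^5$ of Grzegorczyk's hierarchy; that is, there is a function $F:\mathbb{N}^3\to\mathbb{N}$ in $\mathcal{E}^5$ such that $GR(k,m,r)\leq F(k,m,r)$ for all positive integers $k,m,r$.
   Context: For a positive integer $k$, $[k]=\{1,\dots,k\}$, viewed as a finite alphabet. Let $v,v_0,v_1,\dots$ be distinct symbols (variables) not belonging to $[k]$. A variable word $w(v)$ over $k$ of length $n$ is a sequence of length $n$ with entries in $[k]\cup\{v\}$ in which $v$ occurs at least once. An $m$-dimensional variable word $w(v_0,\dots,v_{m-1})$ over $k$ of length $n$ is a sequence $(x_0,\dots,x_{n-1})$ with entries in $[k]\cup\{v_0,\dots,v_{m-1}\}$ such that each $v_j$ occurs at least once and the variables are in block position, i.e. $\max\{i:x_i=v_j\}<\min\{i:x_i=v_{j+1}\}$ for all $0\leq j<m-1$. For an $m$-dimensional variable word $w=w(v_0,\dots,v_{m-1})$ over $k$ and a sequence of symbols $\mathbf{x}=(x_i)_{i=0}^{m-1}$ of length $m$, $w(\mathbf{x})$ denotes the sequence obtained from $w$ by substituting each occurrence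 of $v_i$ by $x_i$, for all $0\leq i<m$. A variable word over $k$ is called reduced by $w$ if it is of the form $w(\mathbf{x})$ for some variable word $\mathbf{x}$ over $k$ of length $m$. An $r$-coloring of a set is a map from it into a set of $r$ colors; a subset is monochromatic if the coloring is constant on it. Grzegorczyk's hierarchy (standard indexing, in which $\mathcal{E}^3$ is the class of Kalmár elementary functions): let $E_0(x,y)=x+y$, $E_1(x)=x^2+2$, and $E_{n+2}(0)=2$, $E_{n+2}(x+1)=E_{n+1}(E_{n+2}(x))$. The class $\mathcal{E}^n$ is the smallest class of functions containing the zero function, the successor function, the projections and the functions $E_i$ with $i<n$, and closed under composition and limited (bounded) primitive recursion. *)

(* Defs.v *)
From mathcomp Require Import all_boot.
Set Implicit Arguments.
Unset Strict Implicit.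
Unset Printing Implicit Defensive.

(* The alphabet [k] = {1, ..., k} is represented by 'I_k.  In words with a
   single variable, [Some a] is the letter a and [None] is the variable v. *)
Definition varword (k n : nat) : Type :=
  {w : n.-tuple (option 'I_k) | None \in w}.

(* In words with m variables, [inl a] is the letter a and [inr j] is v_j. *)
Definition mword (k m n : nat) : Type := n.-tuple ('I_k + 'I_m).

(* The second clause says max {i | x_i = v_j} < min {i | x_i = v_(j+1)}; both
   sets are nonempty by the first clause. *)
Definition is_mvarword (k m n : nat) (w : mword k m n) : Prop :=
  (forall j : 'I_m, inr j \in w) /\
  (forall j j' : 'I_m, j' = j.+1 :> nat ->
   forall i i' : 'I_n, tnth w i = inr j -> tnth w i' = inr j' -> i < i').

Definition subst_word (k m n : nat) (w : mword k m n)
    (x : m.-tuple (option 'I_k)) : n.-tuple (option 'I_k) :=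
  [tuple match tnth w i with inl a => Some a | inr j => tnth x j end | i < n].

Definition reduced_by (k m n : nat) (w : mword k m n) (u : varword k n) : Prop :=
  exists x : varword k m, val u = subst_word w (val x).

Definition monochromatic (T C : Type) (c : T -> C) (A : T -> Prop) : Prop :=
  forall u u' : T, A u -> A u' -> c u = c u'.

Definition GR_property (k m r n0 : nat) : Prop :=
  forall n : nat, n0 <= n -> forall c : varword k n -> 'I_r,
  exists w : mword k m n, is_mvarword w /\ monochromatic c (reduced_by w).

(* N = GR(k, m, r) *)
Definition is_GR (k m r N : nat) : Prop :=
  [/\ 0 < N, GR_property k m r N &
      forall n0 : nat, 0 < n0 -> GR_property k m r n0 -> N <= n0].

(* grzE i is E_(i+1); the binary function E_0 is addition. *)
Fixpoint grzE (i : nat) : nat -> nat :=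
  match i with
  | 0 => fun x => x ^ 2 + 2
  | i'.+1 => fun x => iter x (grzE i') 2
  end.

(* [grz n f] : the a-ary function f belongs to the class E^n.  Arity 0 is
   allowed, so that recursion without parameters is an instance of [grz_rec];
   [grz_ext] makes the class one of functions up to pointwise equality. *)
Inductive grz (n : nat) : forall a : nat, (a.-tuple nat -> nat) -> Prop :=
| grz_zero a : grz n (fun _ : a.-tuple nat => 0)
| grz_succ : grz n (fun x : 1.-tuple nat => (thead x).+1)
| grz_proj a (i : 'I_a) : grz n (fun x : a.-tuple nat => tnth x i)
| grz_add : 0 < n ->
    grz n (fun x : 2.-tuple nat => tnth x ord0 + tnth x ord_max)
| grz_E i : i.+1 < n -> grz n (fun x : 1.-tuple nat => grzE i (thead x))
| grz_comp a b (f : b.-tuple nat -> nat) (g : 'I_b -> a.-tuple nat -> nat) :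
    grz n f -> (forall i, grz n (g i)) ->
    grz n (fun x : a.-tuple nat => f [tuple g i x | i < b])
| grz_rec a (g : a.-tuple nat -> nat) (h : a.+2.-tuple nat -> nat)
    (j f : a.+1.-tuple nat -> nat) :
    grz n g -> grz n h -> grz n j ->
    (forall x : a.-tuple nat, f [tuple of 0 :: x] = g x) ->
    (forall (y : nat) (x : a.-tuple nat),
       f [tuple of y.+1 :: x] = h [tuple of y :: f [tuple of y :: x] :: x]) ->
    (forall z : a.+1.-tuple nat, f z <= j z) ->
    grz n f
| grz_ext a (f g : a.-tuple nat -> nat) : f =1 g -> grz n f -> grz n g.

(* Main.v *)
From Stdlib Require Import Classical Wf_nat.
Require Import Defs.
From mathcomp Require Import all_boot zify.
Set Implicit Arguments.
Unset Strict Implicit.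
Unset Printing Implicit Defensive.

(** The existence is proved by induction on the size k of the alphabet.

    For the inductive step (lemma [GR_exact_succ]) a colouring of the variable
    words over k + 1 letters is first made blind to the exchange of the last
    letter with the one before it, on some subspace of large dimension
    ([shelah_insensitive]).  This is Shelah's argument for the Hales-Jewett
    theorem.  After it the colour of a variable word is the colour of the
    variable word over k letters obtained by merging the two letters, and the
    case of k letters applies.

    Over one letter, a variable word is a nonempty set of positions, and the
    case k = 1 ([GR_exact_one]) asks for m nonempty sets, each of them entirely
    before the next, all of whose nonempty unions have one colour.  Ramsey's
    theorem gives a long set H of positions such that the colour of a subset of
    H depends on its size alone ([ramsey]).  The finite sums theorem, applied to
    the colours of the sizes, then gives sizes all of whose subsums have one
    colour ([finite_sums]), and the sets are consecutive segments of H of these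
    sizes.  The finite sums theorem is proved by iterating a Hilbert cube lemma
    ([hilbert_cube]), as in Taylor's work on disjoint unions.

    For the bounds, let T = [grzE 2] and W = [grzE 3], so that W x is the x-th
    iterate of T at 2.  The Hilbert cube lemma, one step of Ramsey's theorem and
    Shelah's argument each cost a recursion whose step is bounded by a fixed
    number of exponentials, hence at most one value of T.  Each of the three
    processes that repeat them (sums, Ramsey, increase of k) iterates such a
    bound, hence costs at most one value of W.  A fixed number of iterates of
    W at k + m + r is therefore enough, and W = E_4 belongs to the class E^5. *)

(** * Words and substitution *)

(** [None] is the variable and [Some a] a letter.  The alphabet is a predicate
    on words and not a type, so that a smaller alphabet gives a subset of the
    same words. *)
Notation word := (seq (option nat)).

Definition fill (x : option nat) (B : word) : word :=
  [seq if a is Some _ then a else x | a <- B].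

(** Variables in block position cut a word into consecutive words with one
    variable each.  An m-dimensional variable word is therefore a list of m
    variable words, and [plug] is the substitution w(x).  The letters that
    follow the last variable belong to the last block. *)
Fixpoint plug (ws : seq word) (x : word) : word :=
  match ws, x with
  | B :: ws', a :: x' => fill a B ++ plug ws' x'
  | _, _ => [::]
  end.

(** The composite of two substitutions: each block of [ws'] takes as many
    blocks of [ws] as it has symbols, and its letters are plugged there. *)
Fixpoint compose_blocks (ws ws' : seq word) : seq word :=
  if ws' is B :: t
  then plug (take (size B) ws) B :: compose_blocks (drop (size B) ws) t
  else [::].

Definition word_over (k : nat) (u : word) : bool :=
  all (fun a => if a is Some b then b < k else true) u.

Definition varw (k : nat) (u : word) : bool := word_over k u && (None \in u).

Lemma size_fill x B : size (fill x B) = size B.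
Proof. exact: size_map. Qed.

Lemma fill_fill a b B :
  fill a (fill b B) = fill (if b is Some _ then b else a) B.
Proof. by rewrite /fill -map_comp; apply: eq_map => -[c|] //=. Qed.

Lemma fill_plug a ws u : fill a (plug ws u) = plug ws (fill a u).
Proof.
elim: ws u => [|B ws IH] [|b u] //=.
by rewrite {1}/fill map_cat -!/(fill _ _) fill_fill IH.
Qed.

Lemma size_plug ws x : size x = size ws -> size (plug ws x) = size (flatten ws).
Proof.
elim: ws x => [|B ws IH] [|a x] //= [sx].
by rewrite !size_cat size_fill IH.
Qed.

Lemma plug_cat w1 w2 x1 x2 : size x1 = size w1 ->
  plug (w1 ++ w2) (x1 ++ x2) = plug w1 x1 ++ plug w2 x2.
Proof.
by elim: w1 x1 => [|B w1 IH] [|a x1] //= [sx]; rewrite IH // catA.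
Qed.

(** A word reduced by the composite is reduced by [ws], through a word reduced
    by [ws']; this is what allows subspaces to be refined successively. *)
Lemma plug_compose ws ws' x :
  size ws = size (flatten ws') -> size x = size ws' ->
  plug (compose_blocks ws ws') x = plug ws (plug ws' x).
Proof.
elim: ws' ws x => [|B t IH] ws [|a x] //=; first by case: ws.
rewrite size_cat => sws [sx].
have sB : size (take (size B) ws) = size B.
  by rewrite size_takel // sws leq_addr.
rewrite IH // ?size_drop ?sws ?addKn // fill_plug -plug_cat ?size_fill ?sB //.
by rewrite cat_take_drop.
Qed.

Lemma over_cat k u v : word_over k (u ++ v) = word_over k u && word_over k v.
Proof. exact: all_cat. Qed.

Lemma over_fill k a B :
  word_over k [:: a] -> word_over k B -> word_over k (fill a B).
Proof.
rewrite /word_over /= andbT all_map => ka; apply: sub_all => -[b|] //=.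
Qed.

Lemma over_plug k ws x :
  all (word_over k) ws -> word_over k x -> word_over k (plug ws x).
Proof.
elim: ws x => [|B ws IH] [|a x] //= /andP[kB kws] /andP[ka kx].
by rewrite over_cat over_fill ?IH //= andbT.
Qed.

Lemma varw_over k ws : all (varw k) ws -> all (word_over k) ws.
Proof. by apply: sub_all => u /andP[]. Qed.

Lemma fill_None B : fill None B = B.
Proof. by rewrite /fill -[RHS]map_id; apply: eq_map => -[]. Qed.

Lemma None_plug k ws x : all (varw k) ws -> size x = size ws -> None \in x ->
  None \in plug ws x.
Proof.
elim: ws x => [|B ws IH] [|a x] //= /andP[/andP[_ vB] vws] [sx].
rewrite inE mem_cat => /orP[/eqP<-|vx]; first by rewrite fill_None vB.
by rewrite IH ?orbT.
Qed.

Lemma varw_plug k ws x : all (varw k) ws -> size x = size ws -> varw k x ->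
  varw k (plug ws x).
Proof.
move=> vws sx /andP[kx vx].
by rewrite /varw over_plug ?varw_over // (None_plug vws).
Qed.

Lemma size_compose ws ws' : size (compose_blocks ws ws') = size ws'.
Proof. by elim: ws' ws => //= B t IH ws; rewrite IH. Qed.

Lemma size_flatten_compose ws ws' : size ws = size (flatten ws') ->
  size (flatten (compose_blocks ws ws')) = size (flatten ws).
Proof.
elim: ws' ws => [|B t IH] ws /=; first by case: ws.
rewrite !size_cat => sws.
have sB : size (take (size B) ws) = size B.
  by rewrite size_takel // sws leq_addr.
rewrite IH ?size_drop ?sws ?addKn // size_plug //.
by rewrite -size_cat -flatten_cat cat_take_drop.
Qed.

Lemma varw_compose k ws ws' : all (varw k) ws -> all (varw k) ws' ->
  size ws = size (flatten ws') -> all (varw k) (compose_blocks ws ws').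
Proof.
elim: ws' ws => [|B t IH] ws //= vws /andP[vB vt]; rewrite size_cat => sws.
move: vws; rewrite -{1}(cat_take_drop (size B) ws) all_cat => /andP[v1 v2].
rewrite IH ?size_drop ?sws ?addKn // varw_plug // size_takel //.
by rewrite sws leq_addr.
Qed.

(** * Shelah's insensitivity argument and the increase of the alphabet *)

Definition merge_letter (k : nat) (a : option nat) : option nat :=
  if a == Some k then Some k.-1 else a.

(** N is the number of colourings, with [c] colours, of the words of length M'
    on k + 2 symbols (the k + 1 letters and the variable): among N + 1 prefixes
    two induce the same one.  Recording the colours for all the prefixes of
    length N turns [c] colours into c ^ (k.+2 ^ N). *)
Fixpoint shelah (k M c : nat) : nat :=
  if M is M'.+1 then
    let N := c ^ (k.+2 ^ M') in N + shelah k M' (c ^ (k.+2 ^ N))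
  else 0.

Definition untup k n (t : n.-tuple (option 'I_k)) : word :=
  [seq omap val a | a <- t].

Lemma untupP k n (u : word) : word_over k u -> size u = n ->
  exists t : n.-tuple (option 'I_k), untup t = u.
Proof.
move=> ku su; pose g (a : option nat) : option 'I_k := obind insub a.
have st : size (map g u) == n by rewrite size_map su.
exists (Tuple st); rewrite /untup /= -map_comp -[RHS]map_id.
apply/eq_in_map => -[b|] //= /(allP ku) kb.
by rewrite /g /= insubT.
Qed.

Lemma over_untup k n (t : n.-tuple (option 'I_k)) : word_over k (untup t).
Proof. by rewrite /word_over /untup all_map; apply/allP => -[b|] //=. Qed.

(** The remaining blocks are found first, for the colouring which records the
    colours for all prefixes of length N at once.  Among the N + 1 prefixes
    consisting of letters k - 1 followed by letters k, two give the same
    colours together with these blocks.  The positions where the two prefixes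
    differ carry the variable of the new block: setting it to k gives one prefix
    and setting it to k - 1 gives the other. *)
Lemma shelah_insensitive k M (C : finType) (f : word -> C) : 0 < k ->
  exists ws, [/\ size ws = M, all (varw k.+1) ws,
    size (flatten ws) = shelah k M #|C| &
    forall x, word_over k.+1 x -> size x = M ->
      f (plug ws x) = f (plug ws (map (merge_letter k) x))].
Proof.
move=> k0; elim: M C f => [|M IH] C f.
  by exists [::]; split=> // -[].
rewrite /=; set N := _ ^ (_ ^ M).
pose g (y : word) :=
  [ffun u : N.-tuple (option 'I_k.+1) => f (untup u ++ y)].
have [ws [sws vws fws gws]] := IH _ g.
(* Increasing j by one changes a single letter k of [st j] into k - 1. *)
pose st j : word := nseq j (Some k.-1) ++ nseq (N - j) (Some k).
pose h (j : 'I_N.+1) :=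
  [ffun x : M.-tuple (option 'I_k.+1) => f (st j ++ plug ws (untup x))].
have [j [j' [ltjj' hjj']]] : exists j j' : 'I_N.+1, j < j' /\ h j = h j'.
  have /injectivePn[j [j' jj' hjj']] : ~~ injectiveb h.
    apply/negP => /injectiveP /leq_card.
    by rewrite card_ord card_ffun card_tuple card_option card_ord ltnn.
  case: (ltngtP j j') => [lt|lt|/val_inj /eqP]; last by rewrite (negPf jj').
    by exists j, j'.
  by exists j', j.
have lej' : j' <= N by rewrite -ltnS.
pose B : word := nseq j (Some k.-1) ++ nseq (j' - j) None
  ++ nseq (N - j') (Some k).
have fillB a : fill a B =
    nseq j (Some k.-1) ++ nseq (j' - j) a ++ nseq (N - j') (Some k).
  by rewrite /fill !map_cat !map_nseq.
have fk : fill (Some k) B = st j.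
  by rewrite fillB /st -nseqD addnC addnBA ?subnK // ltnW.
have fk1 : fill (Some k.-1) B = st j'.
  by rewrite fillB /st catA -nseqD subnKC // ltnW.
have sB : size B = N.
  by rewrite !size_cat !size_nseq addnA subnKC ?subnKC // ltnW.
have kB : word_over k.+1 B.
  rewrite /word_over !all_cat !all_nseq /= ltnS leq_pred leqnn.
  by rewrite !orbT.
exists (B :: ws); split=> /=; first by rewrite sws.
- rewrite vws andbT /varw kB /= !mem_cat !mem_nseq /=.
  by rewrite subn_gt0 ltjj' /= orbT.
- rewrite size_cat sB fws; congr (_ + shelah _ _ _).
  by rewrite card_ffun card_tuple card_option card_ord.
case=> [//|a x] /= /andP[ka kx] [sx].
have kfa : word_over k.+1 (fill a B) by rewrite over_fill //= ka.
have [u Eu] := untupP kfa (etrans (size_fill _ _) sB).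
have := gws x kx sx; move/ffunP/(_ u); rewrite !ffunE Eu => ->.
rewrite /merge_letter; case: eqP => [->|//].
rewrite fk fk1 -/(merge_letter k).
have kx' : word_over k.+1 (map (merge_letter k) x).
  rewrite /word_over all_map; apply: sub_all kx => -[b|] //=.
  by rewrite /merge_letter; case: eqP => //= _ _; rewrite ltnS leq_pred.
have [t Et] := untupP kx' (etrans (size_map _ _) sx).
by have := hjj'; move/ffunP/(_ t); rewrite !ffunE Et.
Qed.

(** The length is exactly [n], so that it can be the dimension of the subspace
    in which the words are plugged; in [GR_exact_property] the longer words are
    reduced to this case by padding. *)
Definition GR_exact (k m n c : nat) : Prop :=
  forall (C : finType) (f : word -> C), #|C| = c ->
  exists ws, [/\ size ws = m, all (varw k) ws, size (flatten ws) = n &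
    forall x y, size x = m -> size y = m -> varw k x -> varw k y ->
      f (plug ws x) = f (plug ws y)].

Lemma map_merge_over k u : word_over k u -> map (merge_letter k) u = u.
Proof.
move=> ku; rewrite -[RHS]map_id; apply/eq_in_map => -[b|] // /(allP ku) /=.
by rewrite /merge_letter; case: eqP => // -[->]; rewrite ltnn.
Qed.

Lemma merge_plug k ws x : all (word_over k) ws ->
  map (merge_letter k) (plug ws x) = plug ws (map (merge_letter k) x).
Proof.
elim: ws x => [|B ws IH] [|a x] //= /andP[kB kws].
rewrite map_cat IH //; congr (_ ++ _).
rewrite /fill -map_comp; apply/eq_in_map => -[b|] //= /(allP kB) /= kb.
by rewrite /merge_letter; case: eqP kb => // -[->]; rewrite ltnn.
Qed.

Lemma varw_merge k x : 0 < k -> varw k.+1 x -> varw k (map (merge_letter k) x).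
Proof.
move=> k0 /andP[kx vx]; apply/andP; split; last first.
  by apply/mapP; exists None.
rewrite /word_over all_map; apply: sub_all kx => -[b|] //=.
rewrite /merge_letter; case: eqP => [_ _|neq]; first by rewrite prednK.
rewrite ltnS leq_eqVlt => /orP[/eqP eb|//].
by case: neq; rewrite eb.
Qed.

(** The words of the inner list use no letter k, so merging the letters k and
    k - 1 commutes with its substitution and only affects what is plugged. *)
Lemma GR_exact_succ k m n c : 0 < k -> GR_exact k m n c ->
  GR_exact k.+1 m (shelah k n c) c.
Proof.
move=> k0 GRk C f Cc.
have [ws [sws vws fws ins]] := shelah_insensitive n f k0.
have [ws' [sws' vws' fws' mono]] := GRk C (f \o plug ws) Cc.
have vws1 : all (varw k.+1) ws'.
  apply: sub_all vws' => u /andP[ku vu]; rewrite /varw vu andbT.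
  by apply: sub_all ku => -[b|] //= /ltnW.
have sww : size ws = size (flatten ws') by rewrite sws fws'.
exists (compose_blocks ws ws'); split.
- by rewrite size_compose.
- exact: varw_compose.
- by rewrite size_flatten_compose // fws Cc.
have red z : size z = m -> varw k.+1 z ->
    f (plug (compose_blocks ws ws') z) =
    f (plug ws (plug ws' (map (merge_letter k) z))).
  move=> sz vz; rewrite plug_compose ?sz // ins.
  - by rewrite merge_plug // varw_over.
  - by case/andP: (varw_plug vws1 (etrans sz (esym sws')) vz).
  - by rewrite size_plug ?sz.
move=> x y sx sy vx vy; rewrite !red //.
by apply: mono; rewrite ?size_map ?varw_merge.
Qed.

(** * Ramsey's theorem for all sizes at once *)

(** The colour [c0] serves the case n = 0, where [C] could be empty. *)
Lemma pigeonhole (T : Type) (C : finType) (f : T -> C) (c0 : C) s n :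
  #|C| * n <= size s -> exists c, n <= count (fun x => f x == c) s.
Proof.
have -> : size s = \sum_c count (fun x => f x == c) s.
  elim: s => [|x s IH] /=; first by rewrite big1.
  rewrite big_split /= -IH (bigD1 (f x)) //= eqxx big1 // => c.
  by rewrite eq_sym => /negPf->.
rewrite -sum_nat_const => le_n.
apply/existsP; apply: contraLR le_n.
rewrite negb_exists -ltnNge => /forallP lt_n.
rewrite (bigD1 c0) //= [X in _ < X](bigD1 c0) //= -addSn leq_add //.
  by rewrite ltnNge lt_n.
by apply: leq_sum => c _; apply: ltnW; rewrite ltnNge lt_n.
Qed.

Fixpoint end_hom_bound (T c : nat) : nat :=
  if T is T'.+1 then c * (end_hom_bound T' (c * c)).+1 else 0.

(** The set is built from its last element [z] downwards.  The recursion on the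
    pairs of colours of [A] and of [rcons A z] makes both independent of the
    first element of [A].  The only other sequences are the singletons, whose
    colours are made equal by the pigeonhole principle beforehand. *)
Lemma end_homogeneous (T : nat) (C : finType) (c : seq nat -> C) (H : seq nat) :
  end_hom_bound T #|C| <= size H ->
  exists H', [/\ subseq H' H, size H' = T &
    forall A x y, subseq (x :: A) H' -> subseq (y :: A) H' ->
      c (x :: A) = c (y :: A)].
Proof.
elim: T C c H => [|T IH] C c H.
  by exists [::]; split => //; exact: sub0seq.
move=> /= /(pigeonhole (fun x => c [:: x]) (c [::])) [g].
rewrite -size_filter.
have := filter_subseq (fun x => c [:: x] == g) H.
have : all (fun x => c [:: x] == g) [seq x <- H | c [:: x] == g].
  exact: filter_all.
move: [seq _ <- _ | _] => Q; case/lastP: Q => [//|Q z] Qg subQ.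
rewrite size_rcons ltnS -card_prod => leQ.
have [H' [subH' sH' hom]] := IH _ (fun A => (c A, c (rcons A z))) Q leQ.
have subHz : subseq (rcons H' z) (rcons Q z).
  by rewrite -!cats1 cat_subseq.
exists (rcons H' z); split; first exact: subseq_trans subQ.
  by rewrite size_rcons sH'.
(* A last term z is accounted for by the second colour of the pair. *)
have split_last B a : subseq (rcons B a) (rcons H' z) ->
    subseq B H' /\ (a = z \/ subseq (rcons B a) H').
  case/subseqP => m; rewrite size_rcons; case/lastP: m => // m b.
  rewrite size_rcons => -[sm]; rewrite -[rcons H' z]cats1 -[rcons m b]cats1.
  rewrite mask_cat //=; case: b; rewrite ?cats0 ?cats1.
    move=> /rcons_inj[-> ->].
    by split; [exact: mask_subseq | left].
  move=> E; have sub : subseq (rcons B a) H' by rewrite E mask_subseq.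
  by split; [exact: subseq_trans (subseq_rcons _ _) sub | right].
have single x : subseq [:: x] (rcons H' z) -> c [:: x] = g.
  move=> sx; apply/eqP; apply: (allP Qg x); rewrite -sub1seq.
  exact: subseq_trans subHz.
move=> A x y; case/lastP: A => [|A a] sx sy; first by rewrite !single.
have [sx1 sx2] := split_last (x :: A) a sx.
have [sy1 sy2] := split_last (y :: A) a sy.
case: sx2 sy2 => [->|sx2] [eqz|sy2]; try by case: (hom _ _ _ sx1 sy1).
  by rewrite eqz; case: (hom _ _ _ sx1 sy1).
by case: (hom _ _ _ sx2 sy2).
Qed.

Fixpoint ramsey_bound (s L c : nat) : nat :=
  if s is s'.+1 then end_hom_bound (ramsey_bound s' L c).+1 c else L.

(** On an end-homogeneous set, the colour of a sequence is that of its tail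
    after the least element [x0] of the set; applying the result for [s] to
    this colouring of tails gains one in the size. *)
Lemma ramsey (s L : nat) (C : finType) (c : seq nat -> C) (H : seq nat) :
  ramsey_bound s L #|C| <= size H ->
  exists H', [/\ subseq H' H, size H' = L &
    forall A B, subseq A H' -> subseq B H' -> size A = size B -> size A <= s ->
      c A = c B].
Proof.
elim: s c H => [|s IH] c H /=.
  move=> leL; exists (take L H); rewrite take_subseq size_takel //.
  by split=> // -[|? ?] [|? ?].
move=> leH; have [] := @end_homogeneous (ramsey_bound s L #|C|).+1 C c H leH.
case=> [|x0 H1] [subH1 sH1 hom] //.
case: sH1 => sH1.
have sub_tail x A : subseq (x :: A) (x0 :: H1) -> subseq A H1.
  by move=> /=; case: eqP => // _ /(subseq_trans (subseq_cons _ _)).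
have [|H' [subH' sH' homH']] := IH (fun A => c (x0 :: A)) H1.
  by rewrite sH1.
exists H'; split=> //.
  exact: subseq_trans subH' (subseq_trans (subseq_cons _ _) subH1).
case=> [|x A] [|y B] // subA subB [sAB] leA.
have to_min w D : subseq (w :: D) H' -> c (w :: D) = c (x0 :: D).
  move=> subD; have subD1 := subseq_trans subD subH'.
  apply: hom; first exact: subseq_trans subD1 (subseq_cons _ _).
  by rewrite /= eqxx; exact: subseq_trans (subseq_cons _ _) subD1.
rewrite !to_min //; apply: homH' => //.
  exact: subseq_trans (subseq_cons _ _) subA.
exact: subseq_trans (subseq_cons _ _) subB.
Qed.

(** * The finite sums theorem *)

Fixpoint subsum (d : seq nat) (x : nat) : Prop :=
  if d is a :: d' then subsum d' x \/ exists2 y, subsum d' y & x = a + y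
  else x = 0.

Lemma subsum0 d : subsum d 0.
Proof. by elim: d => //= a d IH; left. Qed.

Lemma subsum_cat d1 d2 x y :
  subsum d1 x -> subsum d2 y -> subsum (d1 ++ d2) (x + y).
Proof.
elim: d1 x => [|a d1 IH] x /=; first by move->.
move=> [s1|[z s1 ->]] s2; first by left; apply: IH.
by right; exists (z + y); [apply: IH | rewrite addnA].
Qed.

Lemma subsum_sumn d : subsum d (sumn d).
Proof. by elim: d => //= a d IH; right; exists (sumn d). Qed.

Lemma subsum_nseq S x : subsum (nseq S 1) x -> x <= S.
Proof.
elim: S x => [|S IH] x /=; first by move->.
move=> [/IH/leqW //|[y /IH le_y ->]]; by rewrite add1n ltnS.
Qed.

Lemma subsum_subseq d e x : subseq e d -> subsum e x -> subsum d x.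
Proof.
elim: d e x => [|a d IH] [|b e] x //=.
  by move=> _ ->; left; exact: subsum0.
case: eqP => [->|_] sub; last by move=> s; left; apply: IH sub s.
move=> [s|[y s ->]]; first by left; apply: IH sub s.
by right; exists y => //; apply: IH sub s.
Qed.

Fixpoint cube_bound (L c : nat) : nat :=
  if L is L'.+1 then c + cube_bound L' (c * (c.+1 * c.+1)) else 1.

Definition positive_seq (d : seq nat) := all (fun x => 0 < x) d.

(** For each y, two of the sums p_0 < ... < p_N of the initial segments of [d],
    where N is the number of colours, give one colour to p_i + y and p_j + y.
    The recursion on the rest of [d], applied to the colouring which records
    this colour and the indices, makes the indices constant on a cube, and
    p_j - p_i is the new direction. *)
Lemma hilbert_cube (L : nat) (C : finType) (f : nat -> C) (d : seq nat) :
  positive_seq d -> cube_bound L #|C| <= size d ->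
  exists a e, [/\ 0 < a, positive_seq e, size e = L,
    forall x, subsum (a :: e) x -> subsum d x &
    forall x, subsum e x -> f (a + x) = f a].
Proof.
elim: L C f d => [|L IH] C f d.
  case: d => // a d /= /andP[a0 _] _; exists a, [::]; split=> //.
    move=> x [->|[y -> ->]]; first by left; exact: subsum0.
    by right; exists 0 => //; exact: subsum0.
  by move=> x ->; rewrite addn0.
move=> pd /= led.
set N := #|C| in led.
pose p (i : 'I_N.+1) := sumn (take i d).
pose t (i j : 'I_N.+1) := sumn (drop i (take j d)).
have ltp (i j : 'I_N.+1) : i < j -> 0 < t i j /\ p j = p i + t i j.
  move=> ltij; split.
    have : positive_seq (drop i (take j d)).
      by apply/allP => x /mem_drop/mem_take/(allP pd).
    have : 0 < size (drop i (take j d)).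
      rewrite size_drop size_takel ?subn_gt0 //.
      apply: leq_trans led; apply: leq_trans (leq_addr _ _).
      by rewrite -ltnS.
    rewrite /t; case: (drop _ _) => // b s _ /andP[b0 _] /=.
    by rewrite ltn_addr.
  rewrite /p /t -{1}(cat_take_drop i (take j d)) sumn_cat take_takel //.
  exact: ltnW.
have rep y : exists ij : 'I_N.+1 * 'I_N.+1,
    (ij.1 < ij.2) && (f (p ij.1 + y) == f (p ij.2 + y)).
  have /injectivePn[i [j ij eqf]] :
      ~~ injectiveb (fun i : 'I_N.+1 => f (p i + y)).
    by apply/negP => /injectiveP /leq_card; rewrite card_ord ltnn.
  case: (ltngtP i j) => [lt|lt|/val_inj /eqP]; last by rewrite (negPf ij).
    by exists (i, j); rewrite lt eqf eqxx.
  by exists (j, i); rewrite lt eqf eqxx.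
pose pick_ij y := xchoose (rep y).
have pickP y := xchooseP (rep y).
pose g y := (f (p (pick_ij y).1 + y), pick_ij y).
have cardg : #|{: C * ('I_N.+1 * 'I_N.+1)}| = N * (N.+1 * N.+1).
  by rewrite !card_prod !card_ord.
have pd2 : positive_seq (drop N d) by apply/allP => x /mem_drop/(allP pd).
have [|a [e [a0 pe se sub_e hom]]] := IH _ g (drop N d) pd2.
  by rewrite cardg size_drop leq_subRL // (leq_trans _ led) ?leq_addr.
have /andP[] := pickP a; rewrite -/(pick_ij a).
case Eij : (pick_ij a) => [i j] /= ltij /eqP fij.
have [t0 pj] := ltp _ _ ltij.
have homi x : subsum e x -> f (p i + (a + x)) = f (p i + a).
  by move/hom => []; rewrite Eij /= => Ef Eij'; move: Ef; rewrite Eij'.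
have homj x : subsum e x -> f (p j + (a + x)) = f (p i + a).
  move=> sx; have [_ Eij'] := hom x sx; rewrite Eij in Eij'.
  have /andP[_ /eqP] := pickP (a + x); rewrite -/(pick_ij _) Eij' /= => <-.
  exact: homi.
have sub_d x y z : subsum [:: p i] x -> subsum [:: t i j] y ->
    subsum (drop N d) z -> subsum d (x + y + z).
  have sumn_sub d' w : subsum [:: sumn d'] w -> subsum d' w.
    move=> [->|[_ -> ->]]; first exact: subsum0.
    by rewrite addn0; exact: subsum_sumn.
  move=> /sumn_sub sx /sumn_sub sy sz; rewrite -(cat_take_drop j d).
  rewrite -(cat_take_drop i (take j d)) take_takel ?(ltnW ltij) //.
  apply: subsum_cat; first exact: subsum_cat.
  move: sz.
  have <- : drop (N - j) (drop j d) = drop N d.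
    by rewrite drop_drop subnK // -ltnS.
  by apply: subsum_subseq; exact: drop_subseq.
exists (p i + a), (t i j :: e); split=> /=.
- by rewrite ltn_addl.
- by rewrite t0.
- by rewrite se.
- have self b : subsum [:: b] b by right; exists 0; rewrite ?addn0.
  have nil b : subsum [:: b] 0 by left.
  have tail w : subsum e w -> subsum (a :: e) w by left.
  have head w : subsum e w -> subsum (a :: e) (a + w) by right; exists w.
  move=> x [[sx|[y sy ->]]|[y [sy|[w sw ->]] ->]].
  + by rewrite -[x]/(0 + 0 + x); apply/sub_d/sub_e/tail.
  + by rewrite -[_ + y]/(0 + _ + y); apply/sub_d/sub_e/tail.
  + by rewrite -addnA -[p i]addn0; apply/sub_d/sub_e/head.
  + by rewrite -addnA (addnCA a) addnA; apply/sub_d/sub_e/head.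
- move=> x [sx|[y sy ->]]; first by rewrite -addnA homi.
  by rewrite -addnA (addnCA a) addnA -pj homj.
Qed.

Fixpoint sums_bound (T c : nat) : nat :=
  if T is T'.+1 then cube_bound (sums_bound T' c) c else 0.

(** The colour of a nonempty subsum depends only on its first term. *)
Fixpoint head_determined (C : Type) (f : nat -> C) (s : seq nat) : Prop :=
  if s is a :: s' then
    (forall x, subsum s' x -> f (a + x) = f a) /\ head_determined f s'
  else True.

(** The base point of a cube becomes the first term, and the sequence continues
    inside the directions of the cube. *)
Lemma head_determined_sums (T : nat) (C : finType) (f : nat -> C) d :
  positive_seq d -> sums_bound T #|C| <= size d ->
  exists s, [/\ positive_seq s, size s = T,
    forall x, subsum s x -> subsum d x & head_determined f s].
Proof.
elim: T d => [|T IH] d pd /=.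
  by exists [::]; split=> // x ->; exact: subsum0.
case/(hilbert_cube f pd) => a [e [a0 pe se sub_d hom]].
have [|s [ps ss sub_e hs]] := IH e pe; first by rewrite se.
exists (a :: s); split=> //=; first by rewrite a0.
- by rewrite ss.
- move=> x [sx|[y sy ->]]; apply: sub_d; first by left; apply: sub_e.
  by right; exists y => //; apply: sub_e.
by split=> // x /sub_e; exact: hom.
Qed.

Lemma head_determined_filter (C : eqType) (f : nat -> C) (g : C) s :
  head_determined f s ->
  forall x, subsum [seq a <- s | f a == g] x -> x = 0 \/ f x = g.
Proof.
elim: s => [|a s IH] /=; first by left.
case=> fa /IH{}IH x; case: eqP => [Eg|_] /=; last exact: IH.
case=> [/IH //|[y sy ->]]; right; rewrite fa //.
by apply: subsum_subseq sy; exact: filter_subseq.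
Qed.

(** The colour of a subsum is that of its first term, so m terms of one colour
    are enough.  A sequence of ones to start with bounds the sum of the terms by
    its length. *)
Lemma finite_sums (m : nat) (C : finType) (f : nat -> C) :
  let S := sums_bound (#|C| * m) #|C| in
  exists s, [/\ positive_seq s, size s = m, sumn s <= S &
    forall x y, subsum s x -> subsum s y -> 0 < x -> 0 < y -> f x = f y].
Proof.
move=> S.
have [||s [ps ss sub_s hs]] := @head_determined_sums (#|C| * m) C f (nseq S 1).
- by rewrite /positive_seq all_nseq orbT.
- by rewrite size_nseq.
have [g] := pigeonhole f (f 0) (eq_leq (esym ss)).
rewrite -size_filter => lem; set s' := filter _ s in lem.
have sub' : subseq (take m s') s.
  exact: subseq_trans (take_subseq _ _) (filter_subseq _ _).
exists (take m s'); split.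
- by apply/allP => x /(mem_subseq sub')/(allP ps).
- by rewrite size_takel.
- apply: subsum_nseq; apply: sub_s.
  by apply: subsum_subseq sub' _; exact: subsum_sumn.
have hg x : subsum (take m s') x -> 0 < x -> f x = g.
  move=> /(subsum_subseq (take_subseq _ _)) /(head_determined_filter hs).
  by case=> // ->.
by move=> x y sx sy x0 y0; rewrite !hg.
Qed.

(** * One letter *)

Lemma fill_nseq_None a n : fill a (nseq n None) = nseq n a.
Proof. by rewrite /fill map_nseq. Qed.

(** Letters after the last block can be appended to it, as the substitution does
    not change them. *)
Lemma absorb_tail k ws t : 0 < size ws -> all (varw k) ws -> word_over k t ->
  (forall a, fill a t = t) ->
  exists ws', [/\ size ws' = size ws, all (varw k) ws',
    size (flatten ws') = size (flatten ws) + size t &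
    forall x, size x = size ws -> plug ws' x = plug ws x ++ t].
Proof.
case/lastP: ws => // ws B _; rewrite all_rcons => /andP[/andP[kB vB] vws] kt ft.
exists (rcons ws (B ++ t)); split.
- by rewrite !size_rcons.
- by rewrite all_rcons vws /varw over_cat kB kt mem_cat vB.
- by rewrite -!cats1 !flatten_cat /= !cats0 !size_cat addnA.
move=> x; case/lastP: x => [|x a]; rewrite !size_rcons // => -[sx].
rewrite -!cats1 !plug_cat //= !cats0 -catA; congr (_ ++ _).
by rewrite /fill map_cat -/(fill a t) ft.
Qed.

(** The condition on the empty sequence makes the subtraction n - p exact. *)
Fixpoint increasing_in (p n : nat) (H : seq nat) : bool :=
  if H is h :: H' then [&& p <= h, h < n & increasing_in h.+1 n H'] else p <= n.

Lemma increasing_le p q n H : p <= q -> increasing_in q n H ->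
  increasing_in p n H.
Proof.
case: H => [|h H] /= lepq; first exact: leq_trans.
by case/and3P => /(leq_trans lepq) -> -> ->.
Qed.

Lemma increasing_mask p n b H : increasing_in p n H ->
  increasing_in p n (mask b H).
Proof.
elim: H p b => [|h H IH] p [|[] b] //=.
- by case/and3P => leph ltn _; apply: leq_trans leph (ltnW ltn).
- by case/and3P => -> -> /IH ->.
by case/and3P => leph _ /(IH _ b); apply: (increasing_le (leqW leph)).
Qed.

Lemma increasing_subseq p m H : subseq H (iota p m) ->
  increasing_in p (p + m) H.
Proof.
elim: m p H => [|m IH] p [|h H] //=; rewrite ?leq_addr //.
case: eqP => [->|_] /IH; rewrite addSnnS.
  by move->; rewrite leqnn -addSnnS leq_addr.
exact: (@increasing_le _ _ _ (h :: H)).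
Qed.

(** The characteristic word of [A] on the positions from [p] to [n]. *)
Fixpoint char_word (n p : nat) (A : seq nat) : word :=
  if A is h :: A' then nseq (h - p) (Some 0) ++ None :: char_word n h.+1 A'
  else nseq (n - p) (Some 0).

(** The gap before each element of [H] goes to the block of this element; the
    positions after the last element are left to [after_last]. *)
Fixpoint singleton_blocks (p : nat) (H : seq nat) : seq word :=
  if H is h :: H'
  then rcons (nseq (h - p) (Some 0)) None :: singleton_blocks h.+1 H'
  else [::].

Fixpoint after_last (n p : nat) (H : seq nat) : word :=
  if H is h :: H' then after_last n h.+1 H' else nseq (n - p) (Some 0).

Lemma char_word_shift n p q A : p <= q -> increasing_in q n A ->
  nseq (q - p) (Some 0) ++ char_word n q A = char_word n p A.
Proof.
case: A => [|h A] /= lepq.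
  by move=> leqn; rewrite -nseqD addnC addnBA ?subnK.
by case/andP => leqh _; rewrite catA -nseqD addnC addnBA ?subnK.
Qed.

Lemma plug_singleton_blocks n p H x : increasing_in p n H -> word_over 1 x ->
  size x = size H ->
  plug (singleton_blocks p H) x ++ after_last n p H =
  char_word n p (mask [seq a == None | a <- x] H).
Proof.
elim: H p x => [|h H IH] p [|a x] //= /and3P[leph lthn incH] /andP[ka kx] [sx].
rewrite -catA IH // /fill map_rcons map_nseq cat_rcons.
case: a ka => [[|//]|] //= _.
rewrite -(@char_word_shift n p h.+1) ?leqW ?increasing_mask //.
by rewrite subSn // -[(h - p).+1]addn1 nseqD -catA.
Qed.

Lemma singleton_blocksE p n H : increasing_in p n H ->
  [/\ size (singleton_blocks p H) = size H,
    all (varw 1) (singleton_blocks p H) &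
    size (flatten (singleton_blocks p H)) + size (after_last n p H) = n - p].
Proof.
elim: H p => [|h H IH] p /=; first by rewrite size_nseq.
case/and3P => leph lthn incH; have [-> -> E] := IH _ incH; split=> //.
  rewrite /varw /word_over all_rcons mem_rcons inE eqxx /= !andbT.
  by rewrite all_nseq orbT.
rewrite size_cat size_rcons size_nseq -addnA E -subSn // addnC.
by rewrite addnBA ?subnK // leqW.
Qed.

Lemma after_lastE n p H : word_over 1 (after_last n p H) /\
  forall a, fill a (after_last n p H) = after_last n p H.
Proof.
elim: H p => //= p; split; first by rewrite /word_over all_nseq orbT.
by move=> a; rewrite /fill map_nseq.
Qed.

(** Ramsey's theorem in terms of words over one letter, seen as the
    characteristic words of sets of positions. *)
Lemma count_determined S (C : finType) (f : word -> C) :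
  exists ws t, [/\ size ws = S, all (varw 1) ws,
    word_over 1 t /\ (forall a, fill a t = t),
    size (flatten ws) + size t = ramsey_bound S S #|C| &
    forall x y, word_over 1 x -> word_over 1 y -> size x = S -> size y = S ->
      count_mem None x = count_mem None y ->
      f (plug ws x ++ t) = f (plug ws y ++ t)].
Proof.
set n := ramsey_bound _ _ _.
have [|H [subH sH hom]] :=
  @ramsey S S C (fun A => f (char_word n 0 A)) (iota 0 n).
  by rewrite size_iota.
have incH : increasing_in 0 n H by exact: increasing_subseq subH.
have [s1 v1 f1] := singleton_blocksE incH.
exists (singleton_blocks 0 H), (after_last n 0 H); split=> //.
- by rewrite s1.
- exact: after_lastE.
- by rewrite f1 subn0.
have sizeE z : size z = S ->
    size (mask [seq a == None | a <- z] H) = count_mem None z.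
  by move=> sz; rewrite size_mask ?size_map ?sz ?sH // count_map.
move=> x y kx ky sx sy eqc; rewrite !plug_singleton_blocks ?sx ?sy ?sH //.
apply: hom; rewrite ?mask_subseq ?sizeE //.
by rewrite -sx count_size.
Qed.

Definition gr1_bound (m c : nat) : nat :=
  let S := sums_bound (c * m) c in ramsey_bound S S c.

Lemma count_plug_blocks s x : size x = size s ->
  subsum s (count_mem None (plug [seq nseq a None | a <- s] x)).
Proof.
elim: s x => [|a s IH] [|b x] //= [sx].
rewrite fill_nseq_None count_cat count_nseq /=.
case: (b == None); rewrite ?mul1n ?mul0n.
  right; exists (count_mem None (plug [seq nseq c None | c <- s] x)) => //.
  exact: IH.
by left; exact: IH.
Qed.

(** A term a of the sequence given by the finite sums theorem becomes a block of
    a variables, to be plugged in the blocks given by Ramsey's theorem.  The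
    number of variables of a reduced word is then a subsum.  Since the sum N of
    the terms may be less than the dimension S, the last S - N blocks are
    filled with the letter and absorbed. *)
Lemma GR_exact_one m c : 0 < m -> GR_exact 1 m (gr1_bound m c) c.
Proof.
move=> m0 C f Cc; rewrite /gr1_bound -Cc; set S := sums_bound _ _.
have [ws [t [sws vws [kt ft] szt hom]]] := count_determined S f.
(* [chi i] is the common colour of the reduced words with i variables. *)
pose chi i := f (plug ws (nseq i None ++ nseq (S - i) (Some 0)) ++ t).
have chiE x : word_over 1 x -> size x = S ->
    f (plug ws x ++ t) = chi (count_mem None x).
  move=> kx sx; have lec : count_mem None x <= S by rewrite -sx count_size.
  apply: hom => //; first by rewrite over_cat /word_over !all_nseq !orbT.
    by rewrite size_cat !size_nseq subnKC.
  by rewrite count_cat !count_nseq mul1n addn0.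
have [s [ps ss leS mono]] := finite_sums m chi; rewrite -/S in leS.
set N := sumn s in leS.
pose ws1 := take N ws; pose pad : word := nseq (S - N) (Some 0).
pose t' := plug (drop N ws) pad ++ t.
pose ws' : seq word := [seq nseq a None | a <- s].
have sws' : size ws' = m by rewrite size_map.
have vws' : all (varw 1) ws'.
  rewrite all_map; apply: sub_all ps => a a0 /=.
  by rewrite /varw /word_over all_nseq orbT mem_nseq a0.
have fws' : size (flatten ws') = N.
  rewrite size_flatten /shape -map_comp /N -[in RHS](map_id s).
  by congr sumn; apply: eq_map => a /=; rewrite size_nseq.
have sws1 : size ws1 = N by rewrite size_takel // sws.
have vws12 : all (varw 1) ws1 && all (varw 1) (drop N ws).
  by rewrite -all_cat cat_take_drop.
case/andP: vws12 => vws1 vws2.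
have kpad : word_over 1 pad by rewrite /word_over all_nseq orbT.
have kt' : word_over 1 t' by rewrite over_cat kt andbT over_plug ?varw_over.
have ft' a : fill a t' = t'.
  by rewrite /fill map_cat -!/(fill a _) fill_plug ft /fill map_nseq.
have svc : size (compose_blocks ws1 ws') = m by rewrite size_compose.
have vc : all (varw 1) (compose_blocks ws1 ws') by rewrite varw_compose // sws1.
have [|ws2 [s2 v2 f2 plug2]] := absorb_tail _ vc kt' ft'; first by rewrite svc.
exists ws2; split=> //; first by rewrite s2.
  rewrite f2 size_flatten_compose ?sws1 // size_cat addnA size_plug; last first.
    by rewrite size_nseq size_drop sws.
  by rewrite -size_cat -flatten_cat cat_take_drop.
have red x : size x = m -> varw 1 x ->
    exists i, [/\ f (plug ws2 x) = chi i, subsum s i & 0 < i].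
  move=> sx vx; exists (count_mem None (plug ws' x)).
  have szx : size (plug ws' x) = N by rewrite size_plug ?sx.
  have /andP[kx' vx'] := varw_plug vws' (etrans sx (esym sws')) vx.
  split; last by rewrite -has_count has_pred1.
    rewrite plug2 ?sx // plug_compose ?sx ?sws1 // /t' catA.
    rewrite -plug_cat ?szx ?sws1 //.
    rewrite cat_take_drop chiE ?over_cat ?kx' //.
      by rewrite count_cat count_nseq addn0.
    by rewrite size_cat szx size_nseq subnKC.
  by apply: count_plug_blocks; rewrite sx.
move=> x y sx sy vx vy.
have [i [-> si i0]] := red x sx vx; have [j [-> sj j0]] := red y sy vy.
exact: mono.
Qed.

(** * Words as tuples *)

Lemma plugE ws x : size x = size ws ->
  plug ws x = flatten [seq fill p.2 p.1 | p <- zip ws x].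
Proof. by elim: ws x => [|B ws IH] [|a x] //= [/IH->]. Qed.

Lemma nth_plug ws x i : size x = size ws -> i < size (flatten ws) ->
  nth None (plug ws x) i =
  if nth None (flatten ws) i is Some b then Some b
  else nth None x (reshape_index (shape ws) i).
Proof.
move=> sx; rewrite size_flatten => lti.
have ltr := reshape_indexP lti; rewrite size_map in ltr.
have lto := reshape_offsetP lti; rewrite (nth_map [::]) // in lto.
have shE : shape [seq fill p.2 p.1 | p <- zip ws x] = shape ws.
  elim: ws x sx {lti ltr lto} => [|B ws IH] [|a x] //= [/IH->].
  by rewrite size_fill.
rewrite plugE // !nth_flatten shE; set r := reshape_index _ _.
rewrite (nth_map ([::], None)) ?size_zip ?sx ?minnn // nth_zip //=.
by rewrite (nth_map None) //; case: (nth None _ _).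
Qed.

Section ToTuples.
Variables (k m : nat).

(** [reshape_index] gives the number of the block that contains position i, and
    thus the index of the variable. *)
Definition to_mword (ws : seq word) (n : nat) : mword k.+1 m.+1 n :=
  [tuple if nth None (flatten ws) i is Some b then inl (inord b)
         else inr (inord (reshape_index (shape ws) i)) | i < n].

Lemma to_mword_mvarword ws n : size ws = m.+1 -> all (varw k.+1) ws ->
  size (flatten ws) = n -> is_mvarword (to_mword ws n).
Proof.
move=> sws vws fws; split=> [j|j j' Ej i i'].
  have ltj : j < size ws by rewrite sws.
  have /andP[_] := allP vws _ (mem_nth [::] ltj).
  set B := nth _ _ _ => vB.
  have ltc : index None B < nth 0 (shape ws) j.
    by rewrite (nth_map [::]) // index_mem.
  have lti : flatten_index (shape ws) j (index None B) < n.
    by rewrite -fws size_flatten flatten_indexP.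
  apply/tnthP; exists (Ordinal lti).
  rewrite tnth_mktuple /= nth_flatten flatten_indexKl // flatten_indexKr //.
  by rewrite nth_index // inord_val.
have idx (l : 'I_m.+1) (p : 'I_n) : tnth (to_mword ws n) p = inr l ->
    reshape_index (shape ws) p = l.
  rewrite tnth_mktuple; case: (nth _ _ _) => // -[<-]; rewrite inordK //.
  by rewrite -sws -(size_map size) reshape_indexP // -size_flatten fws.
move=> /idx Ei /idx Ei'; rewrite ltnNge (reshape_leq (shape ws)) Ei Ei' Ej.
by rewrite ltnNge leqnSn /= gtn_eqF.
Qed.

Lemma untup_subst ws n (x : m.+1.-tuple (option 'I_k.+1)) :
  size ws = m.+1 -> all (varw k.+1) ws -> size (flatten ws) = n ->
  untup (subst_word (to_mword ws n) x) = plug ws (untup x).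
Proof.
move=> sws vws fws.
have sx : size (untup x) = size ws by rewrite size_map size_tuple.
apply: (@eq_from_nth _ None); first by rewrite size_map size_tuple size_plug.
move=> i; rewrite size_map size_tuple => lti.
rewrite nth_plug ?fws // (nth_map None) ?size_tuple //.
rewrite -[i]/(val (Ordinal lti)) -tnth_nth !tnth_mktuple.
case E: (nth None (flatten ws) _) => [b|] /=.
  rewrite inordK //; have /allP kf : word_over k.+1 (flatten ws).
    elim: ws vws {sws fws sx E} => //= B ws IH /andP[/andP[kB _] /IH].
    by rewrite /word_over all_cat => ->; rewrite andbT.
  by apply: (kf (Some b)); rewrite -E mem_nth ?fws.
have ltr : reshape_index (shape ws) i < m.+1.
  by rewrite -sws -(size_map size) reshape_indexP // -size_flatten fws.
by rewrite (tnth_nth None) inordK // (nth_map None) ?size_tuple.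
Qed.
End ToTuples.

Lemma mem_untup k n (t : n.-tuple (option 'I_k)) :
  (None \in untup t) = (None \in (t : seq _)).
Proof.
apply/mapP/idP => [[[a|] //]|vt]; by [|exists None].
Qed.

Lemma untup_inj k n : injective (@untup k n).
Proof.
move=> t u /inj_map E; apply: val_inj; apply: E => -[a|] [b|] //= [].
by move=> /val_inj ->.
Qed.

(** Words of length n0 followed by n - n0 letters have length n.  A colouring of
    the variable words is extended to all words by a default colour, so that the
    hypothesis applies to it. *)
Lemma GR_exact_property k m r n0 : 0 < k -> 0 < r -> 0 < m ->
  GR_exact k m n0 r -> GR_property k m r n0.
Proof.
case: k => // k _; case: r => // r _; case: m => // m _ GR n le_n c.
pose pad : word := nseq (n - n0) (Some 0).
pose color (u : word) : 'I_r.+1 :=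
  if [pick t : n.-tuple (option 'I_k.+1) | untup t == u] is Some t then
    if insub t is Some w then c w else ord0
  else ord0.
have colorE (w : varword k.+1 n) : color (untup (val w)) = c w.
  rewrite /color; case: pickP => [t /eqP/untup_inj ->|/(_ (val w))].
    by rewrite valK.
  by rewrite eqxx.
have [ws [sws vws fws mono]] := GR _ (fun u => color (u ++ pad)) (card_ord _).
have kpad : word_over k.+1 pad by rewrite /word_over all_nseq orbT.
have [||ws1 [s1 v1 f1 plug1]] := absorb_tail _ vws kpad; first by rewrite sws.
  by move=> a; rewrite /fill map_nseq.
rewrite sws in s1; have {}f1 : size (flatten ws1) = n.
  by rewrite f1 fws size_nseq subnKC.
exists (to_mword k m ws1 n); split; first exact: to_mword_mvarword.
have red u : reduced_by (to_mword k m ws1 n) u ->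
    exists x, [/\ size x = m.+1, varw k.+1 x & c u = color (plug ws x ++ pad)].
  case=> x Eu; exists (untup (val x)).
  have sx : size (untup (val x)) = m.+1 by rewrite size_map size_tuple.
  split=> //; first by rewrite /varw over_untup mem_untup (valP x).
  by rewrite -colorE Eu untup_subst // plug1 // sws.
by move=> u u' /red[x [sx vx ->]] /red[y [sy vy ->]]; apply: mono.
Qed.

(** The property is not decidable a priori, hence the excluded middle for the
    choice of the least number. *)
Lemma is_GR_le k m r n0 : 0 < n0 -> GR_property k m r n0 ->
  exists N, is_GR k m r N /\ N <= n0.
Proof.
move=> n0_gt0 GR; pose P N := 0 < N /\ GR_property k m r N.
have [N [[[N0 PN] minN] _]] := dec_inh_nat_subset_has_unique_least_element
  P (fun n => classic (P n)) (ex_intro _ n0 (conj n0_gt0 GR)).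
have leN n : 0 < n -> GR_property k m r n -> N <= n.
  by move=> n_gt0 GRn; apply/leP; apply: minN.
by exists N; split; [split | apply: leN].
Qed.

(** The bound for k + 1 letters, as there is at least one letter. *)
Fixpoint gr_bound (k m c : nat) : nat :=
  if k is k'.+1 then shelah k (gr_bound k' m c) c else gr1_bound m c.

Lemma GR_exact_bound k m c : 0 < m -> GR_exact k.+1 m (gr_bound k m c) c.
Proof.
move=> m0; elim: k => [|k IH]; first exact: GR_exact_one.
exact: GR_exact_succ.
Qed.

(** * Growth of the bounds *)

(** The growth conditions that give, uniformly for all functions [grzE i], the
    absorption of sums and products in further iterates. *)
Definition fast (g : nat -> nat) : Prop :=
  (forall x, x ^ 2 + 2 <= g x) /\ (forall x, g x < g x.+1).

Section FastIterates.
Variables (g : nat -> nat) (g_fast : fast g).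

Lemma fast_gt x : x.+1 <= g x.
Proof.
apply: leq_trans (g_fast.1 x); rewrite -addn1 leq_add //.
by case: x => // x; rewrite leq_pmulr.
Qed.

Lemma fast_mono x y : x <= y -> g x <= g y.
Proof.
move/subnK <-; elim: (y - x) => // n IH.
exact: leq_trans IH (ltnW (g_fast.2 _)).
Qed.

Lemma fast_addr x y : g x + y <= g (x + y).
Proof.
elim: y => [|y IH]; first by rewrite !addn0.
by rewrite !addnS; apply: leq_trans (g_fast.2 _); rewrite ltnS.
Qed.

Lemma iter_fast_mono t x y : x <= y -> iter t g x <= iter t g y.
Proof. by move=> lexy; elim: t => //= t; exact: fast_mono. Qed.

Lemma iter_fast_addr t x y : iter t g x + y <= iter t g (x + y).
Proof.
elim: t => //= t IH; apply: leq_trans (fast_addr _ _) _; exact: fast_mono.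
Qed.

Lemma iter_fast_ge t x : t + x <= iter t g x.
Proof. by elim: t => //= t IH; apply: leq_trans (fast_gt _). Qed.

Lemma iter_fast_le s t x a : s <= t -> a <= iter s g x -> a <= iter t g x.
Proof.
move/subnK <- => le_a; rewrite iterD; apply: leq_trans le_a _.
exact: leq_trans (leq_addl _ _) (iter_fast_ge _ _).
Qed.

Lemma iter_fast_add s x a b : a <= iter s g x -> b <= iter s g x ->
  a + b <= iter s.+1 g x.
Proof.
move=> le_a le_b; rewrite iterS; move: (iter s g x) le_a le_b => z le_a le_b.
apply: leq_trans (leq_add le_a le_b) (leq_trans _ (g_fast.1 z)).
by rewrite -mulnn; nia.
Qed.

Lemma iter_fast_mul s x a b : a <= iter s g x -> b <= iter s g x ->
  a * b <= iter s.+1 g x.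
Proof.
move=> le_a le_b; rewrite iterS; apply: leq_trans (leq_mul le_a le_b) _.
by apply: leq_trans (g_fast.1 _); rewrite mulnn leq_addr.
Qed.

(** A number of iterates at an arbitrary point is one value of the next function
    of the hierarchy, as x is at most the x-th iterate of g at 2. *)
Lemma iter_fast_diag t x : iter t g x <= iter (t + x) g 2.
Proof.
rewrite iterD; apply: iter_fast_mono.
exact: leq_trans (leq_addr _ _) (iter_fast_ge _ _).
Qed.

(** All the recursions above have this form: the value at M + 1 is bounded in
    terms of the value at M with a new parameter [q M r], usually the new number
    of colours.  Each step costs a fixed number of iterates of [g], because an
    addend outside an iterate can be moved inside it. *)
Lemma iter_fast_rec (n q : nat -> nat -> nat) (K d s : nat) :
  (forall r, n 0 r <= r + K) ->
  (forall M r, n M.+1 r <= iter d g (n M (q M r) + (M + r + K))) ->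
  (forall M r, q M r <= iter s g (M.+1 + r + K)) ->
  forall M r, n M r <= iter ((d + s + 2) * M) g (M + r + K).
Proof.
move=> n0 nS qs; elim=> [|M IH] r; first by rewrite muln0.
apply: leq_trans (nS M r) _.
set X := M.+1 + r + K.
have le_args : M + q M r + K + (M + r + K) <= iter s.+2 g X.
  have leX a : a <= X -> a <= iter s g X.
    move/leq_trans; apply; apply: leq_trans (iter_fast_ge _ _).
    exact: leq_addl.
  rewrite [M + _ + K]addnAC; apply: iter_fast_add.
    by apply: iter_fast_add; [apply: leX; rewrite /X; lia | exact: qs].
  by apply: (@iter_fast_le s) => //; apply: leX; rewrite /X; lia.
apply: leq_trans (iter_fast_mono _ (leq_add (IH _) (leqnn _))) _.
apply: leq_trans (iter_fast_mono _ (iter_fast_addr _ _ _)) _.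
apply: leq_trans (iter_fast_mono _ (iter_fast_mono _ le_args)) _.
rewrite -!iterD; set c := d + s + 2.
by have -> : d + c * M + s.+2 = c * M.+1 by rewrite /c; lia.
Qed.

End FastIterates.

Lemma fast_iter g : fast g -> fast (fun x => iter x g 2).
Proof.
move=> gf; split=> x; last by rewrite iterS; exact: fast_gt.
elim: x => [//|x IH]; rewrite iterS.
apply: leq_trans (gf.1 _); rewrite leq_add2r leq_exp2r //.
by apply: (@leq_trans (x + 2)); [rewrite addn2 | rewrite iter_fast_ge].
Qed.

Lemma grzE_fast i : fast (grzE i).
Proof.
elim: i => [|i IH]; last exact: fast_iter.
by split=> x //=; rewrite ltn_add2r ltn_exp2r.
Qed.

Lemma iter_grzE_le i t x : iter t (grzE i) x <= grzE i.+1 (t + x).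
Proof. exact/iter_fast_diag/grzE_fast. Qed.

(** This is where the exponentials in the bounds are absorbed. *)
Lemma grzE1_ge x : 2 ^ (2 ^ x) <= grzE 1 x.
Proof.
elim: x => [//|x IH]; rewrite expnSr expnM [grzE 1 _]/= -/(grzE 1 x).
by apply: leq_trans (leq_addr _ _); rewrite leq_exp2r.
Qed.

Lemma iter_grzE1_exp s x a b :
  a <= iter s (grzE 1) x -> b <= iter s (grzE 1) x ->
  a ^ b <= iter s.+2 (grzE 1) x.
Proof.
rewrite !iterS; move: (iter s _ x) => z le_a le_b.
have le_zz : a ^ b <= z ^ z.
  have [->|b_gt0] := posnP b.
    by rewrite expn0; case: (z) => // z'; rewrite expn_gt0.
  by apply: leq_trans (leq_pexp2l _ le_b); [rewrite leq_exp2r | lia].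
apply: leq_trans le_zz (leq_trans _ (grzE1_ge _)).
have le_sq : z * z <= 2 ^ grzE 1 z.
  apply: leq_trans (ltnW (ltn_expl _ (ltnSn 1))).
  by apply: leq_trans ((grzE_fast 1).1 z); rewrite mulnn leq_addr.
apply: (@leq_trans (2 ^ (z * z))); last by rewrite leq_exp2l.
rewrite expnM; have [-> //|z_gt0] := posnP z.
by rewrite leq_exp2r // ltnW // ltn_expl.
Qed.

Lemma le_iter_fast g t X a : fast g -> a <= X -> a <= iter t g X.
Proof.
move=> gf /leq_trans; apply.
exact: leq_trans (leq_addl _ _) (iter_fast_ge gf _ _).
Qed.

(** The recursions for [cube_bound], [end_hom_bound] and [shelah] iterate
    [grzE 1] and are bounded by [grzE 2]; those for [sums_bound],
    [ramsey_bound] and [gr_bound] repeat the former and are bounded by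
    [grzE 3]. *)
Lemma cube_bound_le L c : cube_bound L c <= grzE 2 (5 * L + c + 1).
Proof.
have gf := grzE_fast 1; have le := le_iter_fast _ gf.
have := @iter_fast_rec _ gf cube_bound (fun _ c => c * (c.+1 * c.+1)) 1 0 2.
move/(_ _ _ _ L c) => H; apply: leq_trans (H _ _ _) _ => [r|M r|M r|].
- by rewrite /= leq_addl.
- by rewrite /=; lia.
- apply: iter_fast_mul => //; first by apply: le; lia.
  by apply: iter_fast_mul => //=; lia.
apply: leq_trans (iter_grzE_le _ _ _) _.
by apply: fast_mono; [exact: grzE_fast | lia].
Qed.

Lemma end_hom_bound_le T c : end_hom_bound T c <= grzE 2 (5 * T + c + 1).
Proof.
have gf := grzE_fast 1.
have := @iter_fast_rec _ gf end_hom_bound (fun _ c => c * c) 1 1 1.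
move/(_ _ _ _ T c) => H; apply: leq_trans (H _ _ _) _ => [r|M r|M r|].
- by [].
- by rewrite [end_hom_bound _ _]/=; apply: iter_fast_mul => //=; lia.
- by apply: iter_fast_mul => //=; lia.
apply: leq_trans (iter_grzE_le _ _ _) _.
by apply: fast_mono; [exact: grzE_fast | lia].
Qed.

Lemma shelah_le k M c : shelah k M c <= grzE 2 (16 * M + c + k.+2).
Proof.
have gf := grzE_fast 1; have le := le_iter_fast _ gf.
pose N M c := c ^ (k.+2 ^ M).
have leN M' c' X : M' <= X -> c' <= X -> k.+2 <= X ->
    N M' c' <= iter 4 (grzE 1) X.
  move=> leM lec lek; apply: iter_grzE1_exp; first exact: le.
  by apply: (@iter_grzE1_exp 0).
have := @iter_fast_rec _ gf (shelah k) (fun M c => c ^ (k.+2 ^ N M c)) k.+2 5 8.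
move/(_ _ _ _ M c) => H; apply: leq_trans (H _ _ _) _ => [r|M' r|M' r|].
- by [].
- rewrite [shelah _ _.+1 _]/= -/(N M' r).
  apply: iter_fast_add => //; first by apply: leN; lia.
  by apply: le => //; lia.
- apply: iter_grzE1_exp; first by apply: le; lia.
  apply: iter_grzE1_exp; first by apply: le; lia.
  by apply: leN; lia.
apply: leq_trans (iter_grzE_le _ _ _) _.
by apply: fast_mono; [exact: grzE_fast | lia].
Qed.

Lemma scale_le g s t a Z : fast g -> a <= 2 ^ s * Z -> t = s.+1 ->
  g a <= iter t g Z.
Proof.
move=> gf le_a ->; rewrite iterS; apply: fast_mono => //.
apply: leq_trans le_a _.
elim: s => [|s IH]; first by rewrite mul1n.
by rewrite expnS -mulnA mul2n -addnn; exact: iter_fast_add.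
Qed.

Lemma sums_bound_le T c : sums_bound T c <= grzE 3 (7 * T + c + 1).
Proof.
have gf := grzE_fast 2.
have := @iter_fast_rec _ gf sums_bound (fun _ c => c) 1 4 0.
move/(_ _ _ _ T c) => H; apply: leq_trans (H _ _ _) _ => [r|M r|M r|].
- by [].
- rewrite [sums_bound _ _]/=; apply: leq_trans (cube_bound_le _ _) _.
  by apply: (@scale_le _ 3) => //; lia.
- by rewrite /=; lia.
apply: leq_trans (iter_grzE_le _ _ _) _.
by apply: fast_mono; [exact: grzE_fast | lia].
Qed.

Lemma ramsey_bound_le s L c : ramsey_bound s L c <= grzE 3 (7 * s + L + c + 1).
Proof.
have gf := grzE_fast 2.
have := @iter_fast_rec _ gf (ramsey_bound^~ L) (fun _ c => c) L.+1 4 0.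
move/(_ _ _ _ s c) => H; apply: leq_trans (H _ _ _) _ => [r|M r|M r|].
- by rewrite /=; lia.
- apply: leq_trans (end_hom_bound_le (ramsey_bound M L r).+1 r) _.
  by apply: (@scale_le _ 3) => //; lia.
- by rewrite /=; lia.
apply: leq_trans (iter_grzE_le _ _ _) _.
by apply: fast_mono; [exact: grzE_fast | lia].
Qed.

(** The number of colours stays fixed along this recursion, so it enters the
    constant together with the initial value. *)
Lemma gr_bound_le_gr1 k m c :
  gr_bound k m c <= grzE 3 (8 * k + gr1_bound m c + c + 3).
Proof.
have gf := grzE_fast 2.
have := @iter_fast_rec _ gf (fun k _ => gr_bound k m c) (fun _ _ => 0)
  (gr1_bound m c + c + 3) 5 0.
move/(_ _ _ _ k 0) => H; apply: leq_trans (H _ _ _) _ => [r|M r|M r|].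
- by rewrite /=; lia.
- rewrite [gr_bound _ _ _]/=; apply: leq_trans (shelah_le _ _ _) _.
  by apply: (@scale_le _ 4) => //; lia.
- by [].
apply: leq_trans (iter_grzE_le _ _ _) _.
by apply: fast_mono; [exact: grzE_fast | lia].
Qed.

(** A composition of the preceding estimates; every addition, multiplication or
    application of [grzE 3] adds one iterate, and three iterates exceed the
    numerical constants. *)
Lemma gr_bound_le k m c : gr_bound k m c <= iter 16 (grzE 3) (k + m + c).
Proof.
have gf := grzE_fast 3; set X := k + m + c; pose I t := iter t (grzE 3) X.
have add s a b : a <= I s -> b <= I s -> a + b <= I s.+1.
  exact: iter_fast_add.
have mul s a b : a <= I s -> b <= I s -> a * b <= I s.+1.
  exact: iter_fast_mul.
have le s t a : s <= t -> a <= I s -> a <= I t by exact: iter_fast_le.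
have leX t a : a <= X -> a <= I t by exact: le_iter_fast.
have E t a b : b <= grzE 3 a -> a <= I t -> b <= I t.+1.
  by move/leq_trans => H ?; apply: H; exact: fast_mono.
have I3 : 8 <= I 3.
  have step t : I t ^ 2 + 2 <= I t.+1 by exact: gf.1.
  have := step 2; have := step 1; have := step 0; rewrite -!mulnn; nia.
have const t a : 3 <= t -> a <= 8 -> a <= I t.
  by move=> le3 le8; apply: (le _ _ _ le3); exact: leq_trans I3.
have I8 : sums_bound (c * m) c <= I 8.
  apply: (E _ _ _ (sums_bound_le _ _)); apply: (add); last exact: const.
  apply: (add); last by apply: (leX); rewrite /X; lia.
  apply: (mul); first exact: const.
  by apply: (mul); apply: (leX); rewrite /X; lia.
have I12 : gr1_bound m c <= I 12.
  apply: (E _ _ _ (ramsey_bound_le _ _ _)); apply: (add); last exact: const.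
  apply: (add); last by apply: (leX); rewrite /X; lia.
  rewrite -mulSnr; apply: (mul) => //; exact: const.
rewrite -/(I 16); apply: (E 15 _ _ (gr_bound_le_gr1 _ _ _)).
apply: (add); last exact: const.
apply: (add); last by apply: (leX); rewrite /X; lia.
apply: (add); last exact: I12.
apply: (le 4) => //; apply: (mul); first exact: const.
by apply: (leX); rewrite /X; lia.
Qed.

Lemma grz_ternary_sum n : 0 < n ->
  grz n (fun x : 3.-tuple nat =>
    tnth x (inord 0) + tnth x (inord 1) + tnth x (inord 2)).
Proof.
move=> n0.
have add2 a (f g : a.-tuple nat -> nat) : grz n f -> grz n g ->
    grz n (fun x => f x + g x).
  move=> gf gg; pose h (i : 'I_2) := if i == ord0 then f else g.
  apply: grz_ext (grz_comp (g := h) (grz_add n0) _).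
    by move=> x; rewrite !tnth_mktuple.
  by move=> i; rewrite /h; case: ifP.
by do 2?apply: (add2); exact: grz_proj.
Qed.

Lemma grz_iter_grzE n i a t (f : a.-tuple nat -> nat) : i.+1 < n ->
  grz n f -> grz n (fun x => iter t (grzE i) (f x)).
Proof.
move=> ltin gf; elim: t => //= t IH.
apply: grz_ext (grz_comp (g := fun _ : 'I_1 => _) (grz_E ltin) (fun _ => IH)).
by move=> x; rewrite /thead tnth_mktuple.
Qed.

Definition gr_majorant (x : 3.-tuple nat) : nat :=
  iter 16 (grzE 3) (tnth x (inord 0) + tnth x (inord 1) + tnth x (inord 2)).

Lemma gr_majorant_property k m r : 0 < k -> 0 < m -> 0 < r ->
  GR_property k m r (gr_majorant [tuple k; m; r]).
Proof.
case: k => // k _ m0 r0 n le_n c.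
have GR := GR_exact_property (ltn0Sn k) r0 m0 (GR_exact_bound k (c := r) m0).
apply: GR.
apply: leq_trans (gr_bound_le _ _ _) (leq_trans _ le_n).
apply: iter_fast_mono; first exact: grzE_fast.
by rewrite !(tnth_nth 0) !inordK //= !leq_add2r.
Qed.

Theorem theorem1 :
  (forall k r m : nat, 0 < k -> 0 < r -> 0 < m ->
     exists n0 : nat, 0 < n0 /\ GR_property k m r n0) /\
  (exists F : 3.-tuple nat -> nat, grz 5 F /\
     forall k m r : nat, 0 < k -> 0 < m -> 0 < r ->
       exists N : nat, is_GR k m r N /\ N <= F [tuple k; m; r]).
Proof.
have F0 x : 0 < gr_majorant x.
  exact: leq_trans (fast_gt (grzE_fast 3) _).
split=> [k r m k0 r0 m0|].
  exists (gr_majorant [tuple k; m; r]); split=> //.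
  exact: gr_majorant_property.
exists gr_majorant; split.
  by apply: grz_iter_grzE => //; exact: grz_ternary_sum.
by move=> k m r k0 m0 r0; apply: is_GR_le => //; exact: gr_majorant_property.
Qed.
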